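(* The linear map $\phi:(\mathcal H_{\mathrm{per}},\Uparrow,\Delta_\square)\to(\mathcal H_{\mathrm{vinc}},\heartsuit,\Delta_\blacksquare)$ given on basis elements $\sigma\in\mathbf S$ by $$\phi(\sigma):=\big(\{\{i\}\mid 1\le i\le|\sigma|\},\,\sigma\big)$$ (the permutation $\sigma$ together with the partition of $[|\sigma|]$ into singletons) is an injective homomorphism of Hopf algebras.
   Context: $\mathbb N_{\ge1}=\{1,2,\dots\}$, $[n]=\{1,\dots,n\}$, $[0]=\emptyset$. For a finite set $A\subset\mathbb N_{\ge1}$, an interval partition of $A$ is a finite set $\mathcal I$ of non-empty pairwise disjoint sets (blocks) with union $A$, each block being an interval of $\mathbb N_{\ge1}$ (a set of consecutive integers $\{a,a+1,\dots,b\}$). $\mathbf{IP}(A)$ is the set of these ($\mathbf{IP}(\emptyset)=\{\emptyset\}$), $\mathbf{IP}=\bigcup_A\mathbf{IP}(A)$, and $\bigcup\mathcal I$ denotes the ground set of $\mathcal I$. $\mathbf{StIP}_n:=\mathbf{IP}([n])$. $\mathbf S_n$ is the symmetric group on $[n]$ ($\mathbf S_0$ contains only the empty permutation), permutations being written in one-line notation $\sigma=\sigma_1\cdots\sigma_n$; $\mathbf S=\bigcup_n\mathbf S_n$, and $|\sigma|=n$ for $\sigma\in\mathbf S_n$. Standardization of partitions: for $\mathcal I\in\mathbf{IP}$ with $|\bigcup\mathcal I|=n$, $\mathbf{std}(\mathcal I)\in\mathbf{StIP}_n$ is the image of $\mathcal I$, block by block, under the unique order-preserving bijection $\bigcup\mathcal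 I\to[n]$. Standardization of permutations: for $\sigma\in\mathbf S_n$ and $A=\{a_1<\dots<a_k\}\subset[n]$ (positions), $\mathbf{st}(\sigma|_A)\in\mathbf S_k$ is the permutation with the same relative order as $\sigma_{a_1}\cdots\sigma_{a_k}$. Gluing: for $\mathcal I,\mathcal J\in\mathbf{IP}$, let $\sim$ be the smallest equivalence relation on the set of blocks $\mathcal I\cup\mathcal J$ such that $E\sim F$ whenever $E\cap F\neq\emptyset$. Then $\mathcal I\cdot_{\mathrm{glue}}\mathcal J:=\{\bigcup_{X\in[T]_\sim}X\mid T\in\mathcal I\cup\mathcal J\}$. Concatenations: $\mathfrak s\bullet\mathfrak t$ (for $\mathfrak s\in\mathbf{StIP}_m,\mathfrak t\in\mathbf{StIP}_n$) consists of the blocks of $\mathfrak s$ together with the blocks of $\mathfrak t$ translated by $m$; $\sigma\,\square\,\tau:=\sigma_1\cdots\sigma_m(\tau_1+m)\cdots(\tau_n+m)$ for $\sigma\in\mathbf S_m,\tau\in\mathbf S_n$. $\mathcal H_{\mathrm{per}}$ (Vargas' superinfiltration Hopf algebra) is the free $\mathbb Q$-vector space on $\mathbf S$ with product $\sigma\Uparrow\tau:=\sum_{\gamma\in\mathbf S}\#\{(A,B)\mid A\cup B=[|\gamma|],\ \mathbf{st}(\gamma|_A)=\sigma,\ \mathbf{st}(\gamma|_B)=\tau\}\,\gamma$ and coproduct $\Delta_\square(\sigma):=\sum_{\alpha\square\beta=\sigma}\alpha\otimes\beta$; its unit is the empty permutation and its counit is $1$ on it and $0$ on other basis elements. It is a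 connected filtered Hopf algebra. $\mathcal H_{\mathrm{vinc}}$ is the free $\mathbb Q$-vector space on $\bigcup_n\mathbf{StIP}_n\times\mathbf S_n$, with coproduct $\Delta_\blacksquare((\mathfrak s,\sigma)):=\sum(\mathfrak a,\alpha)\otimes(\mathfrak b,\beta)$, the sum over all basis elements $(\mathfrak a,\alpha),(\mathfrak b,\beta)$ with $\mathfrak a\bullet\mathfrak b=\mathfrak s$, $\alpha\,\square\,\beta=\sigma$, and product $(\mathfrak s,\sigma)\heartsuit(\mathfrak t,\tau):=\sum_{(\mathfrak g,\gamma)}\langle(\mathfrak s,\sigma)\otimes(\mathfrak t,\tau),\Delta_\heartsuit((\mathfrak g,\gamma))\rangle(\mathfrak g,\gamma)$ (pairing making basis elements orthonormal), where $\Delta_\heartsuit((\mathfrak g,\gamma)):=\sum_{A\cup A'=\bigcup\mathfrak g}\ \sum_{\mathcal I\in\mathbf{IP}(A),\,\mathcal I'\in\mathbf{IP}(A'),\ \mathcal I\cdot_{\mathrm{glue}}\mathcal I'=\mathfrak g}(\mathbf{std}(\mathcal I),\mathbf{st}(\gamma|_A))\otimes(\mathbf{std}(\mathcal I'),\mathbf{st}(\gamma|_{A'}))$ (outer sum over ordered pairs of not necessarily disjoint subsets). Its unit is $(\emptyset,\text{empty permutation})$ and its counit is $1$ on this element and $0$ on the other basis elements. It is a connected filtered Hopf algebra. *)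

(* Defs.v *)
From HB Require Import structures.
From mathcomp Require Import all_boot all_order all_fingroup all_algebra.
From mathcomp Require Import finmap.
From mathcomp.multinomials Require Export monalg.

Set Implicit Arguments.
Unset Strict Implicit.
Unset Printing Implicit Defensive.

Import GRing.Theory.
Local Open Scope ring_scope.

(* Conventions.  {malg rat[K]} is the free Q-vector space on K, << k >> is the
   basis element k and x@_k the coefficient of k in x.  The tensor product of
   the free spaces on K and L is the free space on K * L.  The set [n] is 'I_n,
   that is, all positions and values are shifted down by one. *)

Section FreeSpaces.

Definition linext (K : choiceType) (V : lmodType rat) (f : K -> V)
    (x : {malg rat[K]}) : V :=
  \sum_(k <- msupp x) x@_k *: f k.

Definition tensor (K L : choiceType) (x : {malg rat[K]}) (y : {malg rat[L]}) :
    {malg rat[(K * L)%type]} :=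
  \sum_(k <- msupp x) \sum_(l <- msupp y) (x@_k * y@_l) *: << (k, l) >>.

Definition tensor_map (K K' L L' : choiceType)
    (f : {malg rat[K]} -> {malg rat[K']}) (g : {malg rat[L]} -> {malg rat[L']}) :
    {malg rat[(K * L)%type]} -> {malg rat[(K' * L')%type]} :=
  linext (fun p => tensor (f << p.1 >>) (g << p.2 >>)).

End FreeSpaces.

(* The operations of a Hopf algebra on the free space on K, given on basis
   elements. *)
Record hopf_ops (K : choiceType) := HopfOps {
  bmul : K -> K -> {malg rat[K]};
  hone : {malg rat[K]};
  bcomul : K -> {malg rat[(K * K)%type]};
  bcounit : K -> rat
}.

Section HopfMorphisms.

Definition hmulT (K : choiceType) (H : hopf_ops K) :
    {malg rat[(K * K)%type]} -> {malg rat[K]} :=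
  linext (fun p => bmul H p.1 p.2).

Definition hmul (K : choiceType) (H : hopf_ops K) (x y : {malg rat[K]}) :
    {malg rat[K]} := hmulT H (tensor x y).

Definition hcomul (K : choiceType) (H : hopf_ops K) :
    {malg rat[K]} -> {malg rat[(K * K)%type]} := linext (bcomul H).

Definition hcounit (K : choiceType) (H : hopf_ops K) : {malg rat[K]} -> rat :=
  linext (V := rat^o) (bcounit H).

Record is_antipode (K : choiceType) (H : hopf_ops K)
    (S : {malg rat[K]} -> {malg rat[K]}) : Prop := IsAntipode {
  antipode_linear : linear S;
  antipode_left : forall x,
    hmulT H (tensor_map S idfun (hcomul H x)) = hcounit H x *: hone H;
  antipode_right : forall x,
    hmulT H (tensor_map idfun S (hcomul H x)) = hcounit H x *: hone H
}.

(* An antipode is unique when it exists, so it is not part of hopf_ops;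
   compatibility is required of the antipodes of H and H'. *)
Record hopf_morphism (K K' : choiceType) (H : hopf_ops K) (H' : hopf_ops K')
    (f : {malg rat[K]} -> {malg rat[K']}) : Prop := HopfMorphism {
  hopf_morphism_linear : linear f;
  hopf_morphism_mul : forall x y, f (hmul H x y) = hmul H' (f x) (f y);
  hopf_morphism_one : f (hone H) = hone H';
  hopf_morphism_comul : forall x,
    hcomul H' (f x) = tensor_map f f (hcomul H x);
  hopf_morphism_counit : forall x, hcounit H' (f x) = hcounit H x;
  hopf_morphism_antipode : forall S S',
    is_antipode H S -> is_antipode H' S' -> forall x, f (S x) = S' (f x)
}.

End HopfMorphisms.

(* T n is the set of basis elements of degree n. *)
Section GradedBases.

Variable T : nat -> finType.

Definition gbasis : choiceType := {n : nat & T n}.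

Definition mkb n (t : T n) : gbasis := Tagged (fun n => T n) t.

Definition deg (x : gbasis) : nat := tag x.

Definition sum_upto (V : zmodType) (N : nat) (F : gbasis -> V) : V :=
  \sum_(n < N.+1) \sum_(t : T n) F (mkb t).

Lemma sum_upto_delta (N : nat) (F : gbasis -> rat) (x : gbasis) :
  sum_upto N (fun y => F y * (y == x)%:R) = F x *+ (deg x <= N)%N.
Proof.
rewrite /sum_upto; case: x => m t; rewrite /deg /=.
have off n (u : T n) : n != m -> F (mkb u) * (mkb u == existT _ m t)%:R = 0.
  move=> neq; case: eqP => [e|_]; last by rewrite mulr0.
  by move/(congr1 (@tag _ _))/eqP: e; rewrite /= (negbTE neq).
have diag : \sum_(u : T m) F (mkb u) * (mkb u == existT _ m t)%:R = F (mkb t).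
  rewrite (bigD1 t) //= eqxx mulr1 big1 ?addr0 // => u neq.
  case: eqP => [/eqP e|_]; last by rewrite mulr0.
  by rewrite eq_Tagged /= (negbTE neq) in e.
have [leN|gtN] := leqP m N; last first.
  rewrite big1 // => i _; apply: big1 => u _; apply: off.
  by rewrite neq_ltn (leq_trans (ltn_ord i) gtN).
have ltN : (m < N.+1)%N by [].
rewrite (bigD1 (Ordinal ltN)) //= diag big1 ?addr0 // => i neq.
by apply: big1 => u _; apply: off.
Qed.

Lemma coef_sum_upto (N : nat) (F : gbasis -> rat) (x : gbasis) :
  (sum_upto N (fun y => F y *: (<< y >> : {malg rat[gbasis]})))@_x
    = F x *+ (deg x <= N)%N.
Proof.
rewrite -sum_upto_delta /sum_upto raddf_sum; apply: eq_bigr => n _.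
rewrite raddf_sum; apply: eq_bigr => t _.
by rewrite /= mcoeffZ mcoeffU.
Qed.

End GradedBases.

Section Positions.

Variables (n : nat) (A : {set 'I_n}).

Lemma ltn_enum_val : {mono (@enum_val _ (mem A)) : i j / (i < j)%N}.
Proof.
have sA : sorted ltn (map val (enum A)).
  rewrite -[enum _](eq_filter (mem_enum _)).
  rewrite -(eq_filter (mem_map val_inj _)) -filter_map.
  by rewrite (sorted_filter ltn_trans) // unlock val_ord_enum iota_ltn_sorted.
have hom : {homo (@enum_val _ (mem A)) : i j / (i < j)%N}.
  move=> i j lt_ij; pose x0 := enum_val i.
  rewrite !(enum_val_nth x0) -!(nth_map x0 (val x0) val) -?cardE //.
  by apply: (sorted_ltn_nth ltn_trans) => //; rewrite inE size_map -cardE.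
move=> i j; case: (ltngtP i j) => [/hom -> //|/hom /ltnW|/val_inj ->].
  by rewrite leqNgt => /negbTE.
by rewrite ltnn.
Qed.

Lemma leq_enum_val : {mono (@enum_val _ (mem A)) : i j / (i <= j)%N}.
Proof. by move=> i j; rewrite leqNgt ltn_enum_val -leqNgt. Qed.

End Positions.

Section IntervalPartitions.

Definition is_interval n (B : {set 'I_n}) : bool :=
  [exists a : 'I_n, exists b : 'I_n, B == [set x : 'I_n | (a <= x <= b)%N]].

Definition is_ip n (A : {set 'I_n}) (P : {set {set 'I_n}}) : bool := partition P A && [forall B in P, is_interval B].

(* Only subsets of [n] are needed as ground sets, so intervals and blocks live
   in {set 'I_n}; the blocks are intervals of [n], not of A. *)
Record IP n (A : {set 'I_n}) :=
  MkIP { blocks :> {set {set 'I_n}}; _ : is_ip A blocks }.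
HB.instance Definition _ n (A : {set 'I_n}) := [isSub for @blocks n A].
HB.instance Definition _ n (A : {set 'I_n}) := [Finite of IP A by <:].

(* connect is the reflexive transitive closure; overlap is symmetric, so this
   is the equivalence relation it generates. *)
Definition overlap n (P Q : {set {set 'I_n}}) : rel {set 'I_n} := fun E F =>
  [&& E \in P :|: Q, F \in P :|: Q & E :&: F != set0].

Definition glue n (P Q : {set {set 'I_n}}) : {set {set 'I_n}} :=
  [set \bigcup_(X in P :|: Q | connect (overlap P Q) T X) X | T in P :|: Q].

(* enum_val : 'I_#|A| -> A is the increasing bijection, so the image of B
   under its inverse is a preimage under enum_val. *)
Definition std_blocks n (A : {set 'I_n}) (P : {set {set 'I_n}}) :
    {set {set 'I_#|A|}} :=
  [set (@enum_val _ (mem A)) @^-1: B | B : {set 'I_n} in P].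

Lemma std_subproof n (A : {set 'I_n}) (I : IP A) : is_ip [set: 'I_#|A|] (std_blocks A I).
Proof.
case: I => P /= /andP[/and3P[/eqP cP /trivIsetP tP P0] /'forall_implyP iP].
have sub B : B \in P -> B \subset A by move=> BP; rewrite -cP (bigcup_sup B).
have rk B x : B \in P -> x \in B -> exists i : 'I_#|A|, enum_val i = x.
  move=> BP xB; have xA : x \in A := subsetP (sub _ BP) _ xB.
  by exists (enum_rank_in xA x); rewrite enum_rankK_in.
have ne B : B \in P -> exists x, x \in B.
  by move=> BP; apply/set0Pn; apply: contraNneq P0 => <-.
apply/andP; split; first apply/and3P; first split.
- rewrite eqEsubset subsetT /=; apply/subsetP => i _.
  have: enum_val i \in cover P by rewrite cP enum_valP.
  case/bigcupP => B BP iB; apply/bigcupP.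
  by exists ((@enum_val _ (mem A)) @^-1: B); rewrite ?inE ?imset_f.
- apply/trivIsetP => _ _ /imsetP[B BP ->] /imsetP[C CP ->] neq.
  have /tP : B != C by apply: contraNneq neq => ->.
  move=> /(_ BP CP); rewrite -!setI_eq0 => /eqP BC0.
  by rewrite -preimsetI BC0 preimset0.
- apply/imsetP => -[B BP /setP e]; have [x xB] := ne _ BP.
  by have [i ei] := rk _ _ BP xB; move: (e i); rewrite !inE ei xB.
apply/'forall_implyP => _ /imsetP[B BP ->].
have /existsP[a /existsP[b /eqP eB]] := iP _ BP; have [x xB] := ne _ BP.
have leab : (a <= b)%N.
  by move: xB; rewrite eB inE => /andP[]; apply: leq_trans.
have [i ei] := rk _ a BP ltac:(by rewrite eB inE leqnn).
have [j ej] := rk _ b BP ltac:(by rewrite eB inE leqnn leab).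
apply/existsP; exists i; apply/existsP; exists j; apply/eqP/setP => k.
by rewrite !inE eB inE -ei -ej !leq_enum_val.
Qed.

Lemma singletons_subproof n :
  is_ip [set: 'I_n] [set [set i] | i : 'I_n in [set: 'I_n]].
Proof.
apply/andP; split; first apply/and3P; first split.
- rewrite eqEsubset subsetT /=; apply/subsetP => i _; apply/bigcupP.
  by exists [set i]; rewrite ?inE ?imset_f.
- apply/trivIsetP => _ _ /imsetP[i _ ->] /imsetP[j _ ->] neq.
  by rewrite disjoints1 inE; apply: contraNneq neq => ->.
- by apply/imsetP => -[i _ /setP /(_ i)]; rewrite !inE eqxx.
apply/'forall_implyP => _ /imsetP[i _ ->].
apply/existsP; exists i; apply/existsP; exists i; apply/eqP/setP => j.
by rewrite !inE -eqn_leq eq_sym.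
Qed.

End IntervalPartitions.

Definition StIP (n : nat) : finType := IP [set: 'I_n].

Definition std n (A : {set 'I_n}) (I : IP A) : StIP #|A| :=
  MkIP (std_subproof I).

Definition singletons (n : nat) : StIP n := MkIP (singletons_subproof n).

Section PartitionConcatenation.

Variables m n : nat.

Definition bullet_blocks (s : StIP m) (t : StIP n) : {set {set 'I_(m + n)}} :=
  [set (@lshift m n) @: B | B : {set 'I_m} in blocks s]
    :|: [set (@rshift m n) @: B | B : {set 'I_n} in blocks t].

Lemma bullet_subproof s t : is_ip [set: 'I_(m + n)] (bullet_blocks s t).
Proof.
case: s t => P HP [Q HQ]; rewrite /bullet_blocks /=.
case/andP: HP => /and3P[/eqP cP /trivIsetP tP P0] /'forall_implyP iP.
case/andP: HQ => /and3P[/eqP cQ /trivIsetP tQ Q0] /'forall_implyP iQ.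
have LR (B : {set 'I_m}) (C : {set 'I_n}) :
    [disjoint (@lshift m n) @: B & (@rshift m n) @: C].
  rewrite -setI_eq0; apply/eqP/setP => x; rewrite !inE.
  apply/andP => -[/imsetP[i _ ->] /imsetP[j _ /eqP]].
  by rewrite eq_lrshift.
apply/andP; split; first apply/and3P; first split.
- rewrite eqEsubset subsetT /=; apply/subsetP => x _; apply/bigcupP.
  case: (split_ordP x) => i ->.
    have: i \in cover P by rewrite cP inE.
    case/bigcupP => B BP iB; exists ((@lshift m n) @: B); last exact: imset_f.
    by rewrite inE imset_f.
  have: i \in cover Q by rewrite cQ inE.
  case/bigcupP => B BP iB; exists ((@rshift m n) @: B); last exact: imset_f.
  by rewrite inE orbC imset_f.
- apply/trivIsetP => X Y; rewrite !inE.
  case/orP=> /imsetP[B BP ->]; case/orP=> /imsetP[C CP ->] neq //.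
  + have /tP : B != C by apply: contraNneq neq => ->.
    move=> /(_ BP CP); rewrite -!setI_eq0 => /eqP BC0.
    by rewrite -imsetI ?BC0 ?imset0 // => ? ? _ _; apply: lshift_inj.
  + by rewrite disjoint_sym.
  + have /tQ : B != C by apply: contraNneq neq => ->.
    move=> /(_ BP CP); rewrite -!setI_eq0 => /eqP BC0.
    by rewrite -imsetI ?BC0 ?imset0 // => ? ? _ _; apply: rshift_inj.
- rewrite inE negb_or; apply/andP; split; apply/imsetP => -[B BP /esym/eqP].
    by rewrite imset_eq0 => /eqP B0; rewrite B0 (negbTE P0) in BP.
  by rewrite imset_eq0 => /eqP B0; rewrite B0 (negbTE Q0) in BP.
apply/'forall_implyP => X; rewrite inE; case/orP=> /imsetP[B BP ->].
  have /existsP[a /existsP[b /eqP ->]] := iP _ BP.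
  apply/existsP; exists (lshift n a); apply/existsP; exists (lshift n b).
  apply/eqP/setP => x; rewrite inE; case: (split_ordP x) => i ->.
    by rewrite mem_imset ?inE //; apply: lshift_inj.
  apply/imsetP/andP => [[j _ /eqP]|[_]]; first by rewrite eq_rlshift.
  by rewrite /= leqNgt (leq_trans (ltn_ord b)) ?leq_addr.
have /existsP[a /existsP[b /eqP ->]] := iQ _ BP.
apply/existsP; exists (rshift m a); apply/existsP; exists (rshift m b).
apply/eqP/setP => x; rewrite inE; case: (split_ordP x) => i ->.
  apply/imsetP/andP => [[j _ /eqP]|[+ _]]; first by rewrite eq_lrshift.
  by rewrite /= leqNgt (leq_trans (ltn_ord i)) ?leq_addr.
by rewrite mem_imset ?inE /= ?leq_add2l //; apply: rshift_inj.
Qed.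

Definition bullet (s : StIP m) (t : StIP n) : StIP (m + n) :=
  MkIP (bullet_subproof s t).

End PartitionConcatenation.

Section Permutations.

Section Standardization.

Variables (n : nat) (s : {perm 'I_n}) (A : {set 'I_n}).

Let word (i : 'I_#|A|) : 'I_n := s (enum_val i).

Lemma st_fun_subproof i : (#|[set j | (word j < word i)%N]| < #|A|)%N.
Proof.
rewrite -[X in (_ < X)%N]card_ord -cardsT; apply: proper_card.
by rewrite properT; apply: contraTneq (in_setT i) => <-; rewrite inE ltnn.
Qed.

Definition st_fun i : 'I_#|A| := Ordinal (st_fun_subproof i).

Lemma ltn_st_fun i j : (st_fun i < st_fun j)%N = (word i < word j)%N.
Proof.
have sub k l : (word k <= word l)%N -> (st_fun k <= st_fun l)%N.
  move=> le_kl; apply: subset_leq_card; apply/subsetP => x; rewrite !inE.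
  by move=> lt_xk; apply: leq_trans le_kl.
have [lt_ij|/sub le_ji] := ltnP (word i) (word j); last by rewrite ltnNge le_ji.
apply: proper_card; rewrite properE; apply/andP; split.
  by apply/subsetP => x; rewrite !inE => /ltn_trans; apply.
by apply/subsetPn; exists i; rewrite !inE ?ltnn.
Qed.

Lemma st_fun_inj : injective st_fun.
Proof.
move=> i j e; apply/enum_val_inj/(@perm_inj _ s)/val_inj/eqP.
have := ltn_st_fun i j; have := ltn_st_fun j i; rewrite e ltnn.
by case: ltngtP.
Qed.

Definition st : 'S_#|A| := perm st_fun_inj.

(* st is the permutation with the same relative order as the word s|_A. *)
Lemma ltn_st i j : (st i < st j)%N = (s (enum_val i) < s (enum_val j))%N.
Proof. by rewrite !permE ltn_st_fun. Qed.

End Standardization.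

Section Concatenation.

Variables (m n : nat) (s : 'S_m) (t : 'S_n).

Definition square_fun (i : 'I_(m + n)) : 'I_(m + n) :=
  match split i with
  | inl j => lshift n (s j)
  | inr j => rshift m (t j)
  end.

Lemma square_fun_inj : injective square_fun.
Proof.
move=> i j; rewrite /square_fun.
case: (split_ordP i) => k ->; case: (split_ordP j) => l -> /eqP.
- by rewrite eq_lshift => /eqP/perm_inj ->.
- by rewrite eq_lrshift.
- by rewrite eq_rlshift.
- by rewrite eq_rshift => /eqP/perm_inj ->.
Qed.

Definition square : 'S_(m + n) := perm square_fun_inj.

End Concatenation.

End Permutations.

Section Hper.

Definition per_graded (n : nat) : finType := 'S_n.

Definition per : choiceType := gbasis per_graded.

Definition mkper n (s : 'S_n) : per := mkb (T := per_graded) s.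

Definition per0 : per := mkper (1%g : 'S_0).

Definition per_square (x y : per) : per := mkper (square (tagged x) (tagged y)).

Definition pattern n (g : 'S_n) (A : {set 'I_n}) : per := mkper (st g A).

Definition superinf_coef (x y g : per) : nat :=
  #|[set p : {set 'I_(deg g)} * {set 'I_(deg g)} |
      [&& p.1 :|: p.2 == [set: 'I_(deg g)],
          pattern (tagged g) p.1 == x & pattern (tagged g) p.2 == y]]|.

(* Since A :|: B = [|g|] with #|A| = |x| and #|B| = |y|, only permutations g
   with |g| <= |x| + |y| occur; see coef_superinf. *)
Definition superinf (x y : per) : {malg rat[per]} :=
  sum_upto (deg x + deg y) (fun g => (superinf_coef x y g)%:R *: << g >>).

Lemma coef_superinf x y g : (superinf x y)@_g = (superinf_coef x y g)%:R.
Proof.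
rewrite coef_sum_upto; case: leqP => //= gt_deg.
case E: (superinf_coef x y g) => [//|k]; move: (ltn0Sn k); rewrite -E.
case/card_gt0P=> -[A B]; rewrite inE /=.
case/and3P=> /eqP cAB /eqP eA /eqP eB.
move: gt_deg; rewrite -eA -eB {1 2}/deg /= ltnNge -[X in (X <= _)%N]card_ord -cardsT.
by rewrite -cAB leq_card_setU.
Qed.

(* per_square a b = x forces deg a, deg b <= deg x; likewise in vinc_comul. *)
Definition per_comul (x : per) : {malg rat[(per * per)%type]} :=
  sum_upto (deg x) (fun a => sum_upto (deg x) (fun b =>
    (per_square a b == x)%:R *: << (a, b) >>)).

Definition Hper : hopf_ops per := {|
  bmul := superinf;
  hone := << per0 >>;
  bcomul := per_comul;
  bcounit := fun x => (x == per0)%:R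
|}.

End Hper.

Section Hvinc.

Definition vinc_graded (n : nat) : finType := (StIP n * 'S_n)%type.

Definition vinc : choiceType := gbasis vinc_graded.

Definition mkvinc n (p : StIP n) (s : 'S_n) : vinc :=
  mkb (T := vinc_graded) (p, s).

(* The only interval partition of the empty set is the empty one, which is
   singletons 0. *)
Definition vinc0 : vinc := mkvinc (singletons 0) (1%g : 'S_0).

Definition vinc_square (x y : vinc) : vinc :=
  mkvinc (bullet (tagged x).1 (tagged y).1) (square (tagged x).2 (tagged y).2).

Definition vpattern n (g : 'S_n) (A : {set 'I_n}) (I : IP A) : vinc :=
  mkvinc (std I) (st g A).

Definition delta_heart (x : vinc) : {malg rat[(vinc * vinc)%type]} :=
  let: (p, g) := tagged x in
  \sum_(A : {set 'I_(deg x)}) \sum_(A' : {set 'I_(deg x)} |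
        A :|: A' == [set: 'I_(deg x)])
    \sum_(I : IP A) \sum_(I' : IP A' | glue I I' == blocks p)
      << (vpattern g I, vpattern g I') >>.

(* As for superinf, the degree bound loses no term; see coef_heart. *)
Definition heart (x y : vinc) : {malg rat[vinc]} :=
  sum_upto (deg x + deg y) (fun z => (delta_heart z)@_(x, y) *: << z >>).

Lemma coef_heart x y z : (heart x y)@_z = (delta_heart z)@_(x, y).
Proof.
rewrite coef_sum_upto; case: leqP => //= gt_deg; apply/esym.
rewrite /delta_heart; case: (tagged z) => p g.
rewrite raddf_sum big1 // => A _; rewrite raddf_sum big1 // => A' /eqP cAA.
rewrite raddf_sum big1 // => I _; rewrite raddf_sum big1 // => I' _.
rewrite /= mcoeffU; case: eqP => // e.
move: gt_deg; rewrite -[x]/((x, y).1) -[in deg y](_ : (x, y).2 = y) // -e.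
rewrite {1 2}/deg /= ltnNge.
by rewrite -[X in (X <= _)%N]card_ord -cardsT -cAA leq_card_setU.
Qed.

Definition vinc_comul (x : vinc) : {malg rat[(vinc * vinc)%type]} :=
  sum_upto (deg x) (fun a => sum_upto (deg x) (fun b =>
    (vinc_square a b == x)%:R *: << (a, b) >>)).

Definition Hvinc : hopf_ops vinc := {|
  bmul := heart;
  hone := << vinc0 >>;
  bcomul := vinc_comul;
  bcounit := fun x => (x == vinc0)%:R
|}.

End Hvinc.

Definition phi : {malg rat[per]} -> {malg rat[vinc]} :=
  linext (fun x : per => << mkvinc (singletons (deg x)) (tagged x) >>).

(* Main.v *)
Require Import Defs.
From mathcomp Require Import all_boot all_algebra.
From HB Require Import structures.
From mathcomp Require Import all_fingroup finmap.

(* The basis elements in the range of phi are the pairs whose partition has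
   one-element blocks only.  Standardization and concatenation preserve and
   reflect this property, and gluing the singleton partitions of A and B gives
   the singleton partition of the union of A and B, so phi matches the structure
   constants of both algebras.  For the antipodes, D = S' phi - phi S satisfies
   D * phi = 0 for the convolution product.  By induction on the degree, only the
   term D(x) phi(1) is left in (D * phi)(x), so that D(x) = 0; of the product of
   Hvinc, this uses only bilinearity and the right unit law. *)

Set Implicit Arguments.
Unset Strict Implicit.
Unset Printing Implicit Defensive.

Import GRing.Theory.
Local Open Scope ring_scope.

(** * Linear extension and tensors on free spaces *)

(** Vectors with different supports can then be summed over one common finite set. *)
Lemma linextEw (K : choiceType) (V : lmodType rat) (f : K -> V) (d : {fset K})
    (x : {malg rat[K]}) :
  (msupp x `<=` d)%fset -> linext f x = \sum_(k <- d) x@_k *: f k.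
Proof.
move=> sub; rewrite /linext; apply: big_fset_incl => // k _ kx.
by rewrite mcoeff_outdom ?scale0r.
Qed.

Lemma linext_is_linear (K : choiceType) (V : lmodType rat) (f : K -> V) :
  linear (linext f).
Proof.
move=> a x y; pose d := (msupp x `|` msupp y `|` msupp (a *: x + y))%fset.
rewrite !(@linextEw _ _ _ d) ?fsubsetUr //; last first.
- by rewrite /d -fsetUA fsubsetUl.
- by rewrite /d -fsetUA fsetUCA fsubsetUl.
rewrite scaler_sumr -big_split; apply: eq_bigr => k _ /=.
by rewrite mcoeffD mcoeffZ scalerDl scalerA.
Qed.

HB.instance Definition _ (K : choiceType) (V : lmodType rat) (f : K -> V) :=
  GRing.isLinear.Build rat {malg rat[K]} V *:%R (linext f) (linext_is_linear f).

Lemma linextU (K : choiceType) (V : lmodType rat) (f : K -> V) k :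
  linext f << k >> = f k.
Proof. by rewrite /linext msuppU oner_eq0 big_seq_fset1 mcoeffUU scale1r. Qed.

Lemma eq_linear_basis (K : choiceType) (V : lmodType rat)
    (g h : {malg rat[K]} -> V) :
  linear g -> linear h -> (forall k, g << k >> = h << k >>) -> g =1 h.
Proof.
have decomp (f : {malg rat[K]} -> V) :
    linear f -> f =1 linext (fun k => f << k >>).
  (* [linear f] is only a proposition; packing [f] gives access to [linear_sum] and [linearZ]. *)
  move=> lf x; pose F : {linear {malg rat[K]} -> V} :=
    HB.pack f (GRing.isLinear.Build rat {malg rat[K]} V *:%R f lf).
  rewrite -[f x]/(F x) [in LHS](monalgE x) linear_sum /linext.
  apply: eq_bigr => k _; rewrite -[f]/(F : _ -> _) -linearZ; congr (F _).
  by apply/malgP => l; rewrite mcoeffZ !mcoeffU mulr_natr.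
move=> lg lh e x; rewrite decomp // [RHS]decomp //.
by apply: eq_bigr => k _; rewrite e.
Qed.

(** Push-forward along an injection [d] of bases: only [f k'] can contribute to the coefficient at
    [k'], and the factor tests whether [k'] lies in the image of [d]. *)
Lemma coef_linextU (K K' : choiceType) (d : K -> K') (f : K' -> K)
    (x : {malg rat[K]}) (k' : K') : cancel d f ->
  (linext (fun k => << d k >> : {malg rat[K']}) x)@_k'
    = x@_(f k') *+ (d (f k') == k').
Proof.
move=> dK; move: x; apply: (@eq_linear_basis _ rat^o) => [a u v|a u v|k].
- by rewrite linearP mcoeffD mcoeffZ.
- by rewrite mcoeffD mcoeffZ mulrnDl -mulrnAr.
rewrite linextU !mcoeffU -mulrnA mulnb; congr (_ *+ nat_of_bool _).
by apply/eqP/andP => [<-|[/eqP -> /eqP]]; rewrite ?dK ?eqxx.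
Qed.

Lemma tensorE (K L : choiceType) (x : {malg rat[K]}) (y : {malg rat[L]}) :
  tensor x y = linext (fun k => linext (fun l => << (k, l) >>) y) x.
Proof.
rewrite /linext /tensor; apply: eq_bigr => k _; rewrite scaler_sumr.
by apply: eq_bigr => l _; rewrite scalerA.
Qed.

Lemma tensorU (K L : choiceType) (k : K) (l : L) :
  tensor << k >> << l >> = << (k, l) >>.
Proof. by rewrite tensorE !linextU. Qed.

Lemma tensor_linearl (K L : choiceType) (y : {malg rat[L]}) :
  linear (fun x : {malg rat[K]} => tensor x y).
Proof. by move=> a u v; rewrite !tensorE linearP. Qed.

Lemma tensor_linearr (K L : choiceType) (x : {malg rat[K]}) :
  linear (fun y : {malg rat[L]} => tensor x y).
Proof.
move=> a u v; rewrite !tensorE /linext scaler_sumr -big_split.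
apply: eq_bigr => k _; rewrite -!/(linext _ _) linearP.
by rewrite scalerDr !scalerA mulrC.
Qed.

HB.instance Definition _ (K : choiceType) (H : hopf_ops K) :=
  GRing.Linear.copy (hmulT H) (linext (fun p => bmul H p.1 p.2)).
HB.instance Definition _ (K : choiceType) (H : hopf_ops K) :=
  GRing.Linear.copy (hcomul H) (linext (bcomul H)).
HB.instance Definition _ (K K' L L' : choiceType)
    (f : {malg rat[K]} -> {malg rat[K']})
    (g : {malg rat[L]} -> {malg rat[L']}) :=
  GRing.Linear.copy (tensor_map f g)
    (linext (fun p => tensor (f << p.1 >>) (g << p.2 >>))).

Lemma hcounit_linear (K : choiceType) (H : hopf_ops K) :
  linear (hcounit H : _ -> rat^o).
Proof. exact: linext_is_linear. Qed.

Lemma hmul_linearl (K : choiceType) (H : hopf_ops K) y :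
  linear (fun x => hmul H x y).
Proof. by move=> a u v; rewrite /hmul tensor_linearl linearP. Qed.

Lemma hmul_linearr (K : choiceType) (H : hopf_ops K) x :
  linear (fun y => hmul H x y).
Proof. by move=> a u v; rewrite /hmul tensor_linearr linearP. Qed.

Lemma hmulU (K : choiceType) (H : hopf_ops K) k l :
  hmul H << k >> << l >> = bmul H k l.
Proof. by rewrite /hmul tensorU /hmulT linextU. Qed.

Lemma tensor_mapU (K K' L L' : choiceType)
    (f : {malg rat[K]} -> {malg rat[K']})
    (g : {malg rat[L]} -> {malg rat[L']}) p :
  tensor_map f g << p >> = tensor (f << p.1 >>) (g << p.2 >>).
Proof. exact: linextU. Qed.

(** * Partitions into singletons and gluing *)

Lemma singleton_blocks (T : finType) (A : {set T}) (P : {set {set T}}) :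
  partition P A -> {in P, forall B : {set T}, #|B| = 1%N} ->
  P = [set [set i] | i in A].
Proof.
move=> /and3P[/eqP cP _ _] P1; apply/setP => B.
apply/idP/imsetP => [BP|[i + ->]].
  have /eqP/cards1P[i eB] := P1 B BP; exists i => //.
  by rewrite -cP; apply/bigcupP; exists B; rewrite // eB set11.
rewrite -cP => /bigcupP[C CP iC]; have /eqP/cards1P[j eC] := P1 C CP.
by move: iC CP; rewrite eC inE => /eqP ->.
Qed.

(** Distinct blocks do not meet, so a path of overlaps never leaves its first block and each class
    is a single block. *)
Lemma glue_trivIset n (P Q : {set {set 'I_n}}) :
  trivIset (P :|: Q) -> glue P Q = P :|: Q.
Proof.
move=> /trivIsetP tPQ; have conn E F : connect (overlap P Q) E F -> E = F.
  case/connectP => s + ->; elim: s E => //= G s IH E /andP[/and3P[EP GP EG]].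
  move=> /IH <-; apply/eqP; apply: contraNT EG => /tPQ.
  by rewrite -setI_eq0; apply.
rewrite -[RHS]imset_id; apply: eq_in_imset => T TP.
rewrite (bigD1 T) ?TP ?connect0 //= big1 ?setU0 // => X.
by case/andP=> /andP[_ /conn <-]; rewrite eqxx.
Qed.

Lemma ip_singletons_subproof n (A : {set 'I_n}) :
  is_ip A [set [set i] | i in A].
Proof.
apply/andP; split; first apply/and3P; first split.
- apply/eqP/setP => i; apply/bigcupP/idP => [[_ /imsetP[j jA ->]]|iA].
    by rewrite inE => /eqP ->.
  by exists [set i]; rewrite ?inE ?imset_f.
- apply/trivIsetP => _ _ /imsetP[i _ ->] /imsetP[j _ ->] neq.
  by rewrite disjoints1 inE; apply: contraNneq neq => ->.
- by apply/imsetP => -[i _ /setP /(_ i)]; rewrite !inE eqxx.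
apply/'forall_implyP => _ /imsetP[i _ ->].
apply/existsP; exists i; apply/existsP; exists i; apply/eqP/setP => j.
by rewrite !inE -eqn_leq eq_sym.
Qed.

Definition ip_singletons n (A : {set 'I_n}) : IP A :=
  MkIP (ip_singletons_subproof A).

(** Stated on a bare set of blocks, so that it can be compared across different ground sets. *)
Definition finest n (P : {set {set 'I_n}}) : bool := [forall B in P, #|B| == 1%N].

Lemma ip_finestE n (A : {set 'I_n}) (I : IP A) :
  finest I = (I == ip_singletons A).
Proof.
apply/'forall_implyP/eqP => [I1|-> _ /imsetP[i _ ->]]; last by rewrite cards1.
apply/val_inj/singleton_blocks => [|B /I1/eqP//].
by have /andP[] := valP I.
Qed.

Lemma singletonsE n : singletons n = ip_singletons [set: 'I_n].
Proof. exact: val_inj. Qed.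

(** Every block lies in [A], the image of the injection [enum_val], so standardization keeps block
    sizes. *)
Lemma finest_std n (A : {set 'I_n}) (I : IP A) : finest (std I) = finest I.
Proof.
have cardI B : B \in blocks I -> #|(@enum_val _ (mem A)) @^-1: B| = #|B|.
  move=> BP; have /andP[/and3P[/eqP cP _ _] _] := valP I.
  rewrite -(card_imset _ (@enum_val_inj _ (mem A))); congr #|pred_of_set _|.
  apply/setP => x; apply/imsetP/idP => [[i + ->]|xB]; first by rewrite inE.
  have xA : x \in A by rewrite -cP; apply/bigcupP; exists B.
  by exists (enum_rank_in xA x); rewrite ?inE enum_rankK_in.
apply/'forall_implyP/'forall_implyP => [I1 B BI|I1 _ /imsetP[B BI ->]].
  by rewrite -cardI // I1 // imset_f.
by rewrite cardI // I1.
Qed.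

(** * The basis map underlying [phi], and injectivity *)

Definition dissect (x : per) : vinc := mkvinc (singletons (deg x)) (tagged x).

(** Total on [vinc], so that lying in the image of [dissect] becomes the test
    [dissect (undissect z) == z]. *)
Definition undissect (z : vinc) : per := mkper (tagged z).2.

Lemma dissectK : cancel dissect undissect.
Proof. by case. Qed.

Lemma dissect_undissect z : (dissect (undissect z) == z) = finest (tagged z).1.
Proof.
case: z => n [p g]; rewrite ip_finestE -singletonsE eq_Tagged /= xpair_eqE eqxx.
by rewrite andbT eq_sym.
Qed.

(** Separates the condition on the partition from the one on the permutation; all structure
    constants are compared in this form. *)
Lemma eq_dissect z x :
  (z == dissect x) = finest (tagged z).1 && (undissect z == x).
Proof.
rewrite -dissect_undissect.
apply/eqP/andP => [->|[/eqP e /eqP <-]]; last by rewrite e.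
by rewrite dissectK !eqxx.
Qed.

Lemma phiU x : phi << x >> = << dissect x >>.
Proof. exact: linextU. Qed.

HB.instance Definition _ := GRing.Linear.copy phi
  (linext (fun x : per => << dissect x >> : {malg rat[vinc]})).

Lemma coef_phi x z : (phi x)@_z = x@_(undissect z) *+ finest (tagged z).1.
Proof. by rewrite -dissect_undissect; apply: coef_linextU dissectK. Qed.

Lemma phi_inj : injective phi.
Proof.
move=> x y e; apply/malgP => k; move/(congr1 (mcoeff (dissect k))): e.
by rewrite !(coef_linextU _ _ dissectK) dissectK eqxx.
Qed.


(** * Compatibility with the coproducts *)

Lemma finest_bullet m n (s : StIP m) (t : StIP n) :
  finest (bullet s t) = finest s && finest t.
Proof.
apply/'forall_implyP/andP => [st1|[/'forall_implyP s1 /'forall_implyP t1] B].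
  split; apply/'forall_implyP => B BP.
    rewrite -(card_imset _ (@lshift_inj m n)) st1 //.
    by rewrite inE imset_f.
  rewrite -(card_imset _ (@rshift_inj m n)) st1 //.
  by rewrite inE orbC imset_f.
rewrite inE => /orP[] /imsetP[C CP ->].
  by rewrite card_imset ?s1 //; apply: lshift_inj.
by rewrite card_imset ?t1 //; apply: rshift_inj.
Qed.

Lemma vinc_square_dissect a b x : (vinc_square a b == dissect x) =
  [&& finest (tagged a).1, finest (tagged b).1
    & per_square (undissect a) (undissect b) == x].
Proof. by rewrite eq_dissect finest_bullet andbA. Qed.

Lemma raddf_sum_upto (T : nat -> finType) (U V : zmodType)
    (f : {additive U -> V}) (N : nat) (F : gbasis T -> U) :
  f (sum_upto N F) = sum_upto N (fun x => f (F x)).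
Proof. by rewrite raddf_sum; apply: eq_bigr => n _; rewrite raddf_sum. Qed.

Lemma eq_sum_upto (T : nat -> finType) (V : zmodType) (N : nat)
    (F G : gbasis T -> V) : F =1 G -> sum_upto N F = sum_upto N G.
Proof. by move=> e; apply: eq_bigr => n _; apply: eq_bigr => t _. Qed.

Lemma coef_sum_upto2 (T : nat -> finType) (N : nat)
    (F : gbasis T -> gbasis T -> rat) a b :
  (sum_upto N (fun x => sum_upto N (fun y =>
     F x y *: (<< (x, y) >> : {malg rat[(gbasis T * gbasis T)%type]}))))@_(a, b)
    = F a b *+ ((deg a <= N) && (deg b <= N))%N.
Proof.
(* Read backwards, [sum_upto_delta] turns the right side into a double sum with two deltas, to be
   compared termwise. *)
rewrite -mulnb mulnC mulrnA -(sum_upto_delta N (F a)).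
rewrite -(sum_upto_delta N (fun x => sum_upto N (fun y => F x y * (y == b)%:R))).
rewrite raddf_sum_upto; apply: eq_sum_upto => x; rewrite raddf_sum_upto.
rewrite /sum_upto mulr_suml; apply: eq_bigr => n _.
rewrite mulr_suml; apply: eq_bigr => t _ /=.
by rewrite mcoeffZ mcoeffU xpair_eqE -mulrA -natrM mulnb andbC.
Qed.

Lemma coef_per_comul x a b : (per_comul x)@_(a, b) = (per_square a b == x)%:R.
Proof.
rewrite coef_sum_upto2; case: eqP => [<-|_]; last by rewrite mul0rn.
by rewrite {1 3}/deg /= leq_addr leq_addl.
Qed.

Lemma coef_vinc_comul x a b :
  (vinc_comul x)@_(a, b) = (vinc_square a b == x)%:R.
Proof.
rewrite coef_sum_upto2; case: eqP => [<-|_]; last by rewrite mul0rn.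
by rewrite {1 3}/deg /= leq_addr leq_addl.
Qed.

Lemma phi_comul x :
  hcomul Hvinc (phi x) = tensor_map phi phi (hcomul Hper x).
Proof.
move: x; apply: eq_linear_basis => [a u v|a u v|x]; try by rewrite !linearP.
rewrite phiU /hcomul !linextU; apply/malgP => -[a b].
(* The right side is the push-forward of the coproduct along the injection [dissect] on pairs, so
   [coef_linextU] applies. *)
rewrite [RHS](_ : _ = (linext (fun p => << (dissect p.1, dissect p.2) >>
  : {malg rat[(vinc * vinc)%type]}) (per_comul x))@_(a, b)); last first.
  by congr (_@__); apply: eq_bigr => p _; rewrite !phiU tensorU.
rewrite (@coef_linextU _ _ _ (fun q => (undissect q.1, undissect q.2))).
  2: by case=> u v /=; rewrite !dissectK.
rewrite /= xpair_eqE !dissect_undissect coef_per_comul coef_vinc_comul.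
by rewrite vinc_square_dissect -mulrnA mulnb [in RHS]andbC andbA.
Qed.

(** * Compatibility with the products, units and counits *)

Lemma vpattern_dissect n (g : 'S_n) (A : {set 'I_n}) (I : IP A) x :
  (vpattern g I == dissect x) = (I == ip_singletons A) && (pattern g A == x).
Proof. by rewrite eq_dissect finest_std ip_finestE. Qed.

Lemma glue_ip_singletons n (A B : {set 'I_n}) : A :|: B = [set: 'I_n] ->
  glue (ip_singletons A) (ip_singletons B) = singletons n.
Proof.
move=> AB; have U : blocks (ip_singletons A) :|: ip_singletons B = singletons n.
  by rewrite /= -imsetU AB.
rewrite glue_trivIset U //; have /andP[] := singletons_subproof n.
by case/and3P.
Qed.

(** Only singleton partitions standardize to singletons, so a single pair [(I, J)] can contribute;
    it glues to the singletons of the whole set, which turns the gluing condition into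
    [finest p]. *)
Lemma coef_sum_glue_dissect n (p : StIP n) (g : 'S_n) (A B : {set 'I_n}) x y :
  A :|: B = [set: 'I_n] ->
  (\sum_(I : IP A) \sum_(J : IP B | glue I J == blocks p)
     (<< (vpattern g I, vpattern g J) >>
       : {malg rat[(vinc * vinc)%type]}))@_(dissect x, dissect y)
    = ((pattern g A == x) && (pattern g B == y))%:R *+ finest p.
Proof.
move=> AB; have -> : finest p = (blocks (singletons n) == blocks p).
  by rewrite ip_finestE -singletonsE eq_sym.
rewrite raddf_sum (bigD1 (ip_singletons A)) //= [X in _ + X]big1 ?addr0.
  (* The gluing condition may fail for this [J], so it moves into the summand before the term is
     isolated. *)
  rewrite raddf_sum big_mkcond (bigD1 (ip_singletons B)) //=.
  rewrite [X in _ + X]big1 ?addr0 => [|J /negbTE neJ]; last first.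
    by rewrite mcoeffU xpair_eqE !vpattern_dissect neJ andbF if_same.
  rewrite glue_ip_singletons // mcoeffU xpair_eqE !vpattern_dissect !eqxx /=.
  by case: eqP.
move=> I /negbTE neI; rewrite raddf_sum big1 // => J _.
by rewrite /= mcoeffU xpair_eqE !vpattern_dissect neI.
Qed.

Lemma coef_delta_heart_dissect x y z :
  (delta_heart z)@_(dissect x, dissect y)
    = (superinf_coef x y (undissect z))%:R *+ finest (tagged z).1.
Proof.
(* The cardinal becomes a sum of ones over pairs, then a double sum, matching [delta_heart] term by
   term. *)
case: z => n [p g]; rewrite /superinf_coef -sum1_card natr_sum -sumrMnl.
rewrite /delta_heart /undissect /deg /= raddf_sum.
under [RHS]eq_bigl do rewrite inE /=.
rewrite -[RHS](pair_big_dep (fun=> true)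
  (fun A B => [&& A :|: B == [set: 'I_n], pattern g A == x & pattern g B == y])
  (fun A B => 1 *+ finest p)) /=.
apply: eq_bigr => A _; rewrite raddf_sum big_mkcondr /=.
apply: eq_bigr => B /eqP AB; rewrite coef_sum_glue_dissect //.
by case: ifP; rewrite ?mul0rn.
Qed.

Lemma phi_mul x y : phi (hmul Hper x y) = hmul Hvinc (phi x) (phi y).
Proof.
move: x; apply: eq_linear_basis => [a u v|a u v|k].
- by rewrite hmul_linearl linearP.
- by rewrite linearP hmul_linearl.
move: y; apply: eq_linear_basis => [a u v|a u v|l].
- by rewrite hmul_linearr linearP.
- by rewrite linearP hmul_linearr.
rewrite !phiU !hmulU; apply/malgP => z.
by rewrite coef_phi coef_superinf coef_heart coef_delta_heart_dissect.
Qed.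

Lemma phi_one : phi (hone Hper) = hone Hvinc.
Proof. by rewrite phiU. Qed.

Lemma phi_counit x : hcounit Hvinc (phi x) = hcounit Hper x.
Proof.
move: x; apply: (@eq_linear_basis _ rat^o) => [a u v|a u v|x].
- by rewrite linearP hcounit_linear.
- by rewrite hcounit_linear.
(* [vinc0] is [dissect per0] by computation, and [dissect] is injective. *)
rewrite phiU /hcounit !linextU /= -[vinc0]/(dissect per0).
by rewrite (inj_eq (can_inj dissectK)).
Qed.

(** * Degree zero and the right unit laws *)

(** The value at [i] is the number of smaller values, hence determined by the relative order. *)
Lemma eq_perm_ltn n (s t : 'S_n) :
  (forall i j, (s i < s j)%N = (t i < t j)%N) -> s = t.
Proof.
have rank (u : 'S_n) i : nat_of_ord (u i) = #|[set j | (u j < u i)%N]|.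
  rewrite -(card_imset _ (@perm_inj _ u)).
  rewrite (_ : _ @: _ = [set k : 'I_n | (k < u i)%N]).
    rewrite cardsE -sum1_card -(big_ord_widen n (fun=> 1%N)).
      by rewrite sum1_card card_ord.
    exact: ltnW.
  apply/setP => k; rewrite inE; apply/imsetP/idP => [[j + ->]|lt_k].
    by rewrite inE.
  by exists (u^-1%g k); rewrite ?inE permKV.
move=> e; apply/permP => i; apply: val_inj; rewrite /= (rank s) (rank t).
by apply: eq_card => j; rewrite !inE e.
Qed.

(** Permutations of provably equal degrees live in different types; [e] is eliminated once here,
    leaving values to be compared through [cast_ord]. *)
Lemma eq_mkper m n (s : 'S_m) (t : 'S_n) (e : m = n) :
  (forall i, t (cast_ord e i) = cast_ord e (s i)) -> mkper s = mkper t.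
Proof.
move: t; case: n / e => t st; congr mkper; apply/permP => i.
by have := st i; rewrite !cast_ord_id => ->.
Qed.

Lemma per_square1 (x : per) : per_square x per0 = x.
Proof.
case: x => n s; apply: (@eq_mkper _ _ _ s (addn0 n)) => i.
(* The right half of the positions is ['I_0], so only the left half remains. *)
apply: val_inj; rewrite permE /square_fun; case: split_ordP => [j ->|[]//].
by rewrite /=; congr (val (s _)); apply: val_inj.
Qed.

Lemma enum_val_setT n (e : #|[set: 'I_n]| = n) i :
  @enum_val _ (mem [set: 'I_n]) i = cast_ord e i.
Proof.
apply: val_inj => /=; rewrite (enum_val_nth (cast_ord e i)) enum_setT -enumT.
by rewrite nth_enum_ord // -[X in (_ < X)%N]e.
Qed.

Lemma eq_mkvinc m n (p : StIP m) (q : StIP n) (s : 'S_m) (t : 'S_n) (e : m = n) :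
  blocks q = [set cast_ord e @: B | B : {set 'I_m} in blocks p] ->
  (forall i, t (cast_ord e i) = cast_ord e (s i)) -> mkvinc p s = mkvinc q t.
Proof.
move: q t; case: n / e => q t pq st; congr mkvinc.
  apply: val_inj; rewrite /= pq -[LHS]imset_id; apply: eq_imset => B.
  by rewrite -[LHS]imset_id; apply: eq_imset => i; rewrite cast_ord_id.
by apply/permP => i; have := st i; rewrite !cast_ord_id => ->.
Qed.

Lemma vpattern_setT n (g : 'S_n) (I : IP [set: 'I_n]) :
  vpattern g I = mkvinc I g.
Proof.
have e : #|[set: 'I_n]| = n by rewrite cardsT card_ord.
apply: (@eq_mkvinc _ _ _ _ _ _ e) => [|i].
  rewrite /= -imset_comp -[LHS]imset_id; apply: eq_imset => B.
  apply/setP => k; apply/idP/imsetP => [kB|[i + ->]]; last first.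
    by rewrite inE enum_val_setT.
  by exists (cast_ord (esym e) k); rewrite ?inE ?enum_val_setT cast_ordKV.
(* [h] is the standardization transported to ['S_n]; it has the relative order of [g], hence equals
   [g]. *)
pose h := cast_perm e (st g [set: 'I_n]).
have gh : g = h.
  apply: eq_perm_ltn => j k; rewrite !cast_permE /=.
  by rewrite ltn_st !enum_val_setT !cast_ordKV.
by rewrite [in LHS]gh cast_permE cast_ordK.
Qed.

Lemma ip_set0 n (A : {set 'I_n}) (I : IP A) : A = set0 -> blocks I = set0.
Proof.
have /andP[/and3P[/eqP cI _ I0] _] := valP I; move=> A0; apply/eqP.
rewrite -subset0; apply/subsetP => B BI.
have : B \subset set0 by rewrite -A0 -cI (bigcup_sup B).
by rewrite subset0 => /eqP B0; rewrite B0 (negbTE I0) in BI.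
Qed.

Lemma vinc_deg0 z : (z == vinc0) = (deg z == 0%N).
Proof.
apply/eqP/eqP => [->//|]; case: z => n [p g]; rewrite {1}/deg /= => n0.
have T0 : [set: 'I_n] = set0 by apply/setP => -[i]; rewrite n0.
apply: (@eq_mkvinc _ _ _ _ _ _ n0) => [|i]; last by case: (cast_ord n0 i).
rewrite (ip_set0 p T0) imset0; apply: ip_set0.
by apply/setP => -[].
Qed.

Lemma per_deg0 x : deg x = 0%N -> x = per0.
Proof.
case: x => n g n0; rewrite /deg /= in n0.
by apply: (@eq_mkper _ _ _ _ n0) => i; case: (cast_ord n0 i).
Qed.

(** The second factor is [vinc0] only for an empty second set. Then the first set is everything, and
    gluing with the empty partition changes nothing, so the only term left is [I = p]. *)
Lemma coef_delta_heart1 x z : (delta_heart z)@_(x, vinc0) = (z == x)%:R.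
Proof.
case: z => n [p g]; rewrite /delta_heart {1 2 3 4 5 6 7 8}/deg /= raddf_sum.
have deg0 (A B : {set 'I_n}) (I : IP A) (J : IP B) : B != set0 ->
    (<< (vpattern g I, vpattern g J) >>
      : {malg rat[(vinc * vinc)%type]})@_(x, vinc0) = 0.
  move=> B0; rewrite mcoeffU xpair_eqE vinc_deg0 /deg /= cards_eq0.
  by rewrite (negbTE B0) andbF.
rewrite (bigD1 [set: 'I_n]) //= [X in _ + X]big1 ?addr0 => [|A AT]; last first.
  rewrite raddf_sum big1 // => B /eqP AB.
  rewrite raddf_sum big1 // => I _; rewrite raddf_sum big1 // => J _.
  by apply: deg0; apply: contraNneq AT => B0; rewrite -AB B0 setU0.
rewrite raddf_sum (bigD1 set0) ?setU0 //= [X in _ + X]big1 ?addr0; last first.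
  move=> B /andP[_ B0]; rewrite raddf_sum big1 // => I _.
  by rewrite raddf_sum big1 // => J _; apply: deg0.
have glueE (I : IP [set: 'I_n]) (J : IP (set0 : {set 'I_n})) :
    (glue I J == blocks p) = (I == p).
  have IJ : blocks I :|: J = I by rewrite (ip_set0 J) ?setU0.
  rewrite glue_trivIset IJ //.
  by have /andP[/and3P[]] := valP I.
rewrite raddf_sum (bigD1 p) //= [X in _ + X]big1 ?addr0 => [|I neI]; last first.
  by rewrite raddf_sum big1 // => J; rewrite glueE (negbTE neI).
rewrite raddf_sum (bigD1 (ip_singletons set0)) ?glueE //=.
(* Partitions of the empty set have no blocks, so there is no second [J]. *)
rewrite [X in _ + X]big1 ?addr0 => [|J /andP[_ /eqP[]]]; last first.
  exact/val_inj/(etrans (ip_set0 J erefl))/esym/ip_set0.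
rewrite mcoeffU xpair_eqE vinc_deg0 /deg /= cards0 andbT.
by rewrite vpattern_setT.
Qed.

Lemma heart1 x : hmul Hvinc x << vinc0 >> = x.
Proof.
move: x; apply: eq_linear_basis => // [|x]; first exact: hmul_linearl.
rewrite hmulU; apply/malgP => z.
by rewrite coef_heart coef_delta_heart1 mcoeffU eq_sym.
Qed.

(** * Compatibility with the antipodes *)

Lemma phi_antipode S S' : is_antipode Hper S -> is_antipode Hvinc S' ->
  forall x, phi (S x) = S' (phi x).
Proof.
case=> linS leftS _ [linS' leftS' _].
pose D x := S' (phi x) - phi (S x).
pose conv p := hmul Hvinc (D << p.1 >>) (phi << p.2 >>).
(* Multiplicativity of [phi] gives [phi (S * id) = (phi S) * phi], so the difference of the two
   sides is [D * phi]. *)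
have convE : (fun t => hmulT Hvinc (tensor_map S' idfun (tensor_map phi phi t))
    - phi (hmulT Hper (tensor_map S idfun t))) =1 linext conv.
  apply: eq_linear_basis => [a u v|a u v|[k l]]; rewrite ?linearP //.
    by rewrite scalerDr addrACA.
  rewrite linextU /conv !tensor_mapU /= !phiU tensorU tensor_mapU /=.
  rewrite -/(hmul _ _ _) -/(hmul _ _ _) phi_mul phiU /D phiU.
  by rewrite /hmul !tensorE !linearB.
(* By the left antipode identities, both convolutions are the counit times the unit, which [phi]
   preserves. *)
have conv0 x : linext conv (hcomul Hper x) = 0.
  rewrite -convE -phi_comul leftS' leftS linearZ /= phi_one phi_counit.
  exact: subrr.
have conv1 x : conv (x, per0) = D << x >>.
  by rewrite /conv phiU; apply: heart1.
have D0 n x : (deg x < n)%N -> D << x >> = 0.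
  elim: n x => // n IH x; rewrite ltnS => le_xn.
  have := conv0 << x >>; rewrite /hcomul linextU /linext /=.
  (* This coefficient puts [(x, per0)] in the support and leaves [D << x >>] unscaled. *)
  have coef1 : (per_comul x)@_(x, per0) = 1.
    by rewrite coef_per_comul per_square1 eqxx.
  rewrite (bigD1_seq (x, per0)) ?fset_uniq -?mcoeff_neq0 ?coef1 //=.
  rewrite scale1r conv1 [X in _ + X]big1_seq ?addr0 // => -[a b] /andP[ne _].
  rewrite coef_per_comul; case: eqP => [abx|_]; last by rewrite scale0r.
  have degab : (deg a + deg b)%N = deg x by rewrite -abx.
  (* In degree zero [b] is [per0], which forces [a = x], the pair already removed; otherwise [a] has
     smaller degree than [x] and the induction applies. *)
  have [b0|b0] := posnP (deg b).
    move: ne abx; rewrite (per_deg0 b0) per_square1 => /eqP ne ax.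
    by case: ne; rewrite ax.
  rewrite /conv /hmul tensorE /= IH ?linear0 ?scaler0 //.
  by apply: leq_trans le_xn; rewrite -degab -[X in (X < _)%N]addn0 ltn_add2l.
move=> x; apply/esym/eqP; rewrite -subr_eq0 -/(D x); apply/eqP; move: x.
apply: (@eq_linear_basis _ _ _ (fun=> 0)) => [a u v|a u v|k].
- by rewrite /D linS !linearP linS' scalerDr addrACA.
- by rewrite scaler0 addr0.
exact: D0 (ltnSn _).
Qed.

Theorem proposition4p16 : hopf_morphism Hper Hvinc phi /\ injective phi.
Proof.
split; last exact: phi_inj.
split; first exact: linearP.
- exact: phi_mul.
- exact: phi_one.
- exact: phi_comul.
- exact: phi_counit.
- exact: phi_antipode.
Qed.
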